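(* Consider the two-way dynamic matching model described in the context, suppose it satisfies the GPG condition with parameter $\epsilon$, and suppose the graph $(\mathcal A,\mathcal M_+)$ is connected and acyclic (a tree). Let $r$ be the unique under-demanded type, let $d_r$ be the depth of the tree rooted at $r$, and let $\mathbf{TP}$ be the tree priority policy described in the context. Then there is an absolute constant $C>0$ such that for every $T\ge1$, $$\mathrm{Regret}(\mathbf{TP},T)\le C\, r_{\max}\cdot\frac{n^2\,2^{d_r}}{\epsilon}\left(1+\frac1\epsilon\right)^{\lfloor (d_r-1)/2\rfloor}.$$
   Context: Model. There are $n$ agent types $\mathcal A=\{1,\dots,n\}$ and a finite set $\mathcal M$ of match types; each match $m$ consists of exactly two distinct types and yields reward $r_m>0$; $M\in\{0,1\}^{\mathcal A\times\mathcal M}$ with $M_{im}=1$ iff $m$ involves $i$; $m(i,j)$ denotes the match containing $i$ and $j$. In each discrete period exactly one agent arrives, of type $i$ with probability $\lambda_i>0$ independently ($\sum_i\lambda_i=1$); $A_i(t)$ counts type-$i$ arrivals up to $t$. After the arrival, matches can be performed if a waiting agent of each involved type is present; matched agents leave. $D_m(t)$ counts performances of $m$ up to $t$; $Q_i(t)$ is the number of waiting type-$i$ agents after period $t$, $Q(0)=0$. A truncated queue discards any arriving agent not matched in its arrival period. Regret: $\mathcal R^\Pi(t)=\mathbb E[r^\top D(t)]$, $\mathcal R^*(t)=\mathbb E[\max\{r^\top y: My\le A(t), y\in\mathbb Z^{\mathcal M}_{\ge0}\}]$, $\mathrm{Regret}(\Pi,T)=\sup_{0\le t\le T}(\mathcal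 R^*(t)-\mathcal R^\Pi(t))$. GPG: $\mathrm{SPP}(\lambda)$ = maximize $r^\top z$ s.t. $Mz+s=\lambda$, $z,s\ge0$. GPG holds if it has a non-degenerate optimal basic solution $(z^*,s^* )$ (all $n$ basic variables strictly positive); $\epsilon=\min(\min_{z^*_m>0}z^*_m,\min_{s^*_i>0}s^*_i)$; $\mathcal M_+=\{m:z^*_m>0\}$, $\mathcal A_+=\{i:s^*_i>0\}$, $\mathcal A_0=\mathcal A\setminus\mathcal A_+$, $r_{\max}=\max_{m\in\mathcal M_+}r_m$. When $(\mathcal A,\mathcal M_+)$ is a tree, it is known that $\mathcal A_+=\{r\}$ for a single type $r$; the tree is rooted at $r$, and parent/children are with respect to this rooting. Static priority policy: for each type $i$, a subset $\mathcal M(i)$ of matches in $\mathcal M_+$ containing $i$ and a strict order $\succ_i$ on it; upon arrival of a type-$i$ agent, the policy performs the $\succ_i$-highest match in $\mathcal M(i)$ whose other type has a non-empty queue, if any; otherwise the agent joins queue $i$ (or is discarded if queue $i$ is truncated). The queue of $r$ is truncated. $\mathbf{TP}$: the static priority policy with $\mathcal M(i)$ = all matches of $\mathcal M_+$ containing $i$, and for every $i\in\mathcal A_0$ and every child $j$ of $i$, $m(i,j)\succ_i m(i,\text{parent}(i))$ (order among children arbitrary). *)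

(* Defs.v *)
From HB Require Import structures.
From mathcomp Require Import all_boot all_order all_algebra.
From mathcomp Require Import all_classical all_reals all_analysis.

Set Implicit Arguments.
Unset Strict Implicit.
Unset Printing Implicit Defensive.

Import Order.TTheory GRing.Theory Num.Theory.
Local Open Scope ring_scope.

Section Network.

(* Agent types are 'I_n and match types are the elements of mT.  The set of   *)
(* the two types involved in m is [ends m], so that the incidence matrix is   *)
(* M_{im} = (i \in ends m).                                                   *)
Variables (n : nat) (mT : finType) (ends : mT -> {set 'I_n}).

Definition two_way : Prop := forall m, #|ends m| = 2%N.

Section Graph.

(* [E] is a set of matches, seen as the edge set of a (multi)graph on 'I_n.   *)
Variable E : {set mT}.

Definition adj : rel 'I_n :=
  [rel i j | [exists m in E, (i != j) && (ends m == [set i; j])]].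

Definition graph_connected : Prop := forall i j, connect adj i j.

(* Two parallel edges form a cycle of length 2, which [adj] does not see.     *)
Definition graph_acyclic : Prop :=
  {in E &, injective ends} /\
  (forall c : seq 'I_n, (2 < size c)%N -> ~ ucycle adj c).

Definition is_tree : Prop := graph_connected /\ graph_acyclic.

(* Graph distance; it takes the junk value n when j is not reachable from i.  *)
Definition gdist (i j : 'I_n) : nat :=
  find (fun k => [exists p : k.-tuple 'I_n, path adj i p && (last i p == j)])
       (iota 0 n).

(* Number of edges on a longest path from the root.                           *)
Definition tree_depth (rt : 'I_n) : nat := (\max_(i < n) gdist rt i)%N.

Definition child_of (rt i j : 'I_n) : bool :=
  adj i j && (gdist rt j == (gdist rt i).+1).

Definition parent_of (rt i p : 'I_n) : bool := child_of rt p i.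

End Graph.

(* [pol_prio i m m'] is m >-_i m'.                                            *)
Record policy := Policy {
  pol_matches : 'I_n -> {set mT};
  pol_prio : 'I_n -> rel mT;
  pol_truncated : {set 'I_n} }.

Definition is_static_priority (Mplus : {set mT}) (pol : policy) : Prop :=
  forall i,
  [/\ pol_matches pol i \subset [set m in Mplus | i \in ends m],
      {in pol_matches pol i, irreflexive (pol_prio pol i)},
      {in pol_matches pol i & &, transitive (pol_prio pol i)} &
      {in pol_matches pol i &, forall m m', m != m' ->
        pol_prio pol i m m' || pol_prio pol i m' m}].

(* The order of the children of a type, and the whole order at the root, are  *)
(* left unspecified.                                                          *)
Definition is_tree_priority (Mplus : {set mT}) (Aplus : {set 'I_n})
    (rt : 'I_n) (pol : policy) : Prop :=
  [/\ is_static_priority Mplus pol,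
      forall i, pol_matches pol i = [set m in Mplus | i \in ends m],
      pol_truncated pol = [set rt] &
      forall i j p m m', i \in ~: Aplus ->
        child_of Mplus rt i j -> parent_of Mplus rt i p ->
        m \in Mplus -> ends m = [set i; j] ->
        m' \in Mplus -> ends m' = [set i; p] ->
        pol_prio pol i m m'].

(* A state is the pair (Q, D) of queue lengths and cumulative match counts.   *)
Definition state : Type := ({ffun 'I_n -> nat} * {ffun mT -> nat})%type.

Definition init_state : state := ([ffun=> 0%N], [ffun=> 0%N]).

(* The matches of M(i) whose other type has a waiting agent.                  *)
Definition available (pol : policy) (Q : {ffun 'I_n -> nat}) (i : 'I_n) :
    {set mT} :=
  [set m in pol_matches pol i |
    [exists j, (j != i) && (ends m == [set i; j]) && (0 < Q j)%N]].

Definition choose_match (pol : policy) (Q : {ffun 'I_n -> nat}) (i : 'I_n) :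
    option mT :=
  [pick m in available pol Q i |
    [forall m' in available pol Q i, (m' != m) ==> pol_prio pol i m m']].

(* The arriving agent never enters queue i when it is matched on arrival.     *)
Definition step (pol : policy) (x : state) (i : 'I_n) : state :=
  if choose_match pol x.1 i is Some m then
    ([ffun j => (x.1 j - ((j != i) && (j \in ends m)))%N],
     [ffun m' => (x.2 m' + (m' == m))%N])
  else
    ([ffun j => (x.1 j + ((j == i) && (i \notin pol_truncated pol)))%N], x.2).

(* [a k] is the type of the agent arriving in period k.+1.                    *)
Fixpoint run (pol : policy) (a : nat -> 'I_n) (t : nat) : state :=
  if t is k.+1 then step pol (run pol a k) (a k) else init_state.

Definition performed (pol : policy) (a : nat -> 'I_n) (t : nat) (m : mT) : nat :=
  (run pol a t).2 m.

Definition arrivals (a : nat -> 'I_n) (t : nat) (i : 'I_n) : nat :=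
  (\sum_(k < t) (a k == i))%N.

Section Rewards.

Variables (R : realType) (rew : mT -> R).

(* The feasible set is finite and contains 0, so this supremum is a maximum.  *)
Definition offline_value (A : 'I_n -> nat) : R :=
  sup [set \sum_m rew m * (y m)%:R | y in
        [set y : {ffun mT -> nat} |
          forall i, (\sum_(m | i \in ends m) y m <= A i)%N]]%classic.

Section SPP.

Variable lam : 'I_n -> R.

Definition spp_feasible (z : mT -> R) (s : 'I_n -> R) : Prop :=
  [/\ forall i, \sum_(m | i \in ends m) z m + s i = lam i,
      forall m, 0 <= z m & forall i, 0 <= s i].

Definition spp_optimal (z : mT -> R) (s : 'I_n -> R) : Prop :=
  spp_feasible z s /\
  forall z' s', spp_feasible z' s' ->
    \sum_m rew m * z' m <= \sum_m rew m * z m.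

(* The variables of the program are indexed by mT + 'I_n.                     *)
Definition spp_var (z : mT -> R) (s : 'I_n -> R) (v : mT + 'I_n) : R :=
  match v with inl m => z m | inr i => s i end.

Definition spp_col (v : mT + 'I_n) : 'cV[R]_n :=
  match v with
  | inl m => \col_i (i \in ends m)%:R
  | inr j => \col_i (i == j)%:R
  end.

(* [b] lists the n basic variables.                                           *)
Definition nondegenerate_basic (z : mT -> R) (s : 'I_n -> R) : Prop :=
  exists b : 'I_n -> mT + 'I_n,
  [/\ \matrix_(i, k) spp_col (b k) i 0 \in unitmx,
      forall v, (forall k, b k <> v) -> spp_var z s v = 0 &
      forall k, 0 < spp_var z s (b k)].

Definition gpg_solution (z : mT -> R) (s : 'I_n -> R) : Prop :=
  spp_optimal z s /\ nondegenerate_basic z s.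

End SPP.

Definition active_matches (z : mT -> R) : {set mT} := [set m | 0 < z m].

Definition under_demanded (s : 'I_n -> R) : {set 'I_n} := [set i | 0 < s i].

(* The infimum of a finite set, i.e., the least positive entry of (z, s).     *)
Definition gpg_eps (z : mT -> R) (s : 'I_n -> R) : R :=
  inf [set x | exists2 v, x = spp_var z s v & 0 < x]%classic.

Definition rew_max (z : mT -> R) : R :=
  \big[Num.max/0]_(m in active_matches z) rew m.

Section Arrivals.

Local Open Scope classical_set_scope.

Variables (d : measure_display) (Omega : measurableType d)
  (P : probability Omega R).

Definition mutually_independent (X : nat -> Omega -> 'I_n) : Prop :=
  forall (J : seq nat) (B : nat -> set 'I_n), uniq J ->
    P (\bigcap_(k in [set` J]) (X k @^-1` B k)) =
    (\prod_(k <- J) P (X k @^-1` B k))%E.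

(* As 'I_n is finite, the first clause is the measurability of each X k.      *)
Definition arrival_process (lam : 'I_n -> R) (X : nat -> Omega -> 'I_n) :
    Prop :=
  [/\ forall k i, measurable (X k @^-1` [set i]),
      forall k i, P (X k @^-1` [set i]) = (lam i)%:E &
      mutually_independent X].

Definition policy_reward (X : nat -> Omega -> 'I_n) (pol : policy) (t : nat) :
    \bar R :=
  'E_P[fun w => (\sum_m rew m * (performed pol (X ^~ w) t m)%:R)%R]%E.

Definition offline_reward (X : nat -> Omega -> 'I_n) (t : nat) : \bar R :=
  'E_P[fun w => offline_value (arrivals (X ^~ w) t)]%E.

Definition regret (X : nat -> Omega -> 'I_n) (pol : policy) (T : nat) :
    \bar R :=
  ereal_sup [set (offline_reward X t - policy_reward X pol t)%E | t in
              [set t | (t <= T)%N]].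

End Arrivals.
End Rewards.
End Network.

(* Main.v *)
(* Let p be the multipliers of the optimal basis.  By duality the regret is at
   most E[\sum_i p_i Q_i], and p_i <= rew_max for i <> rt, so it suffices to
   bound the expected queue lengths.  For a function F of the nodes let F~ be
   the alternating sum of F over the subtree below a node.  With A the arrivals
   and D the matches, the excess W_x := A_x - \sum_(c child of x) D_c - A~_x
   satisfies W_x + \sum_c W_c = C_x, where C_x counts the waiting children of x.
   If C_x > 0 after a period, this period has changed W_x by exactly the
   increment of - A~_x, whose mean is - lam~_x <= - eps (lam~_x is the flow
   z* on the edge from x to its parent, or s* at the root); if C_x = 0, then
   W_x <= \sum_g W_g over the grandchildren g of x.  Since A~ is also the sum,
   over the nodes y at even distance below x, of A_y - \sum_(c child of y) A_c,
   these two facts show pathwise that W_x is at most the sum over these y of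
   walks reflected at 0, the increments of the walk of y being the centred
   increments of \sum_c A_c - A_y minus eps / n.  Hence C_x is at most the sum
   of the walks of all nodes.  By Kingman's moment bound the expectations of all
   the walks add up to O(n / eps), so that \sum_x E[C_x] = O(n^2 / eps). *)

Require Import Defs.
From HB Require Import structures.
From mathcomp Require Import all_boot all_order all_algebra.
From mathcomp Require Import all_classical all_reals all_analysis.
From mathcomp Require Import zify ring lra.

Set Implicit Arguments.
Unset Strict Implicit.
Unset Printing Implicit Defensive.

Import Order.TTheory GRing.Theory Num.Theory.
Local Open Scope ring_scope.

(** * Sums over the subtrees of a rooted tree *)

Section TreeSums.

Variables (n : nat) (R : realFieldType) (rt : 'I_n) (par : 'I_n -> 'I_n).
Variable dep : 'I_n -> nat.
Hypothesis dep_par : forall i, i != rt -> dep i = (dep (par i)).+1.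

Definition is_child (x c : 'I_n) : bool := (c != rt) && (par c == x).

Local Notation ch := is_child.

Let height := (\max_x dep x).+1.

Lemma ch_dep x c : ch x c -> dep c = (dep x).+1.
Proof. by case/andP=> cn /eqP <-; apply: dep_par. Qed.

Let dep_lt x : (dep x < height)%N.
Proof. by rewrite ltnS; apply: leq_bigmax. Qed.

(** Induction from the leaves upwards. The hypothesis covers all deeper nodes, as some recursions
    below step to grandchildren. *)
Lemma tree_ind (Pr : 'I_n -> Prop) :
  (forall x, (forall y, (dep x < dep y)%N -> Pr y) -> Pr x) -> forall x, Pr x.
Proof.
move=> H x; move: {2}(height - dep x)%N (leqnn (height - dep x)) => k.
elim: k x => [|k IH] x hk.
  by move: (dep_lt x); rewrite -subn_gt0; move: hk; rewrite leqn0 => /eqP->.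
apply: H => y xy; apply: IH; rewrite -ltnS; apply: leq_trans hk.
by apply: ltn_sub2l => //; apply: dep_lt.
Qed.

(** [k] is fuel. Started at [height - dep x], it drops by one per level and stays positive at every
    node, so the default 0 is never reached. *)
Fixpoint tsum_rec (sg : R) (F : 'I_n -> R) (k : nat) (x : 'I_n) : R :=
  if k is k'.+1 then F x + sg * \sum_(c | ch x c) tsum_rec sg F k' c else 0.

Definition tsum sg F x := tsum_rec sg F (height - dep x) x.

Lemma tsumE sg F x : tsum sg F x = F x + sg * \sum_(c | ch x c) tsum sg F c.
Proof.
rewrite /tsum -[(height - dep x)%N]prednK ?subn_gt0 ?dep_lt //=.
congr (_ + _ * _); apply: eq_bigr => c /ch_dep ->.
by rewrite subnS.
Qed.

Lemma tsum_unique sg F G :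
  (forall x, G x = F x + sg * \sum_(c | ch x c) G c) -> G =1 tsum sg F.
Proof.
move=> HG; apply: tree_ind => x IH; rewrite HG tsumE.
congr (_ + _ * _); apply: eq_bigr => c /ch_dep xc; apply: IH.
by rewrite xc.
Qed.

Definition altsum := tsum (-1).
Definition subsum := tsum 1.
(** The sum of [F] over the nodes at even distance below [x], [x] included: in the alternating sum
    of subtree sums the odd levels cancel. *)
Definition evensum F := altsum (subsum F).

Lemma altsumE F x : altsum F x = F x - \sum_(c | ch x c) altsum F c.
Proof. by rewrite /altsum {1}tsumE mulN1r. Qed.

Lemma subsumE F x : subsum F x = F x + \sum_(c | ch x c) subsum F c.
Proof. by rewrite /subsum {1}tsumE mul1r. Qed.

Lemma subsum_evensum F x :
  subsum F x = evensum F x + \sum_(c | ch x c) evensum F c.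
Proof. by rewrite /evensum [altsum _ x]altsumE subrK. Qed.

Lemma evensumE F x : evensum F x =
  F x + \sum_(c | ch x c) \sum_(g | ch c g) evensum F g.
Proof.
rewrite /evensum {1}altsumE subsumE -addrA -sumrB; congr (_ + _).
by apply: eq_bigr => c _; rewrite -/(evensum F c) subsum_evensum addrC addKr.
Qed.

Lemma evensum_unique F G :
  (forall x, G x = F x + \sum_(c | ch x c) \sum_(g | ch c g) G g) ->
  G =1 evensum F.
Proof.
move=> HG; apply: tree_ind => x IH; rewrite HG evensumE; congr (_ + _).
apply: eq_bigr => c /ch_dep xc; apply: eq_bigr => g /ch_dep cg; apply: IH.
by rewrite cg xc ltnW.
Qed.

(** Groups each node at even distance below [x] with its children, which are at odd distance. *)
Lemma altsum_evensum F x :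
  altsum F x = evensum (fun y => F y - \sum_(c | ch y c) F c) x.
Proof.
move: x; apply: evensum_unique => x; rewrite altsumE -addrA; congr (_ + _).
under eq_bigr => c _ do rewrite altsumE.
by rewrite sumrB opprB addrC.
Qed.

Lemma evensumD F G x :
  evensum (fun y => F y + G y) x = evensum F x + evensum G x.
Proof.
apply/esym; move: x; apply: (evensum_unique (G := fun x => evensum F x + evensum G x)) => x.
rewrite {1}(evensumE F) {1}(evensumE G) addrACA; congr (_ + _).
by rewrite -big_split; apply: eq_bigr => c _; rewrite -big_split.
Qed.

Lemma evensumZ a F x : evensum (fun y => a * F y) x = a * evensum F x.
Proof.
apply/esym; move: x; apply: (evensum_unique (G := fun x => a * evensum F x)) => x.
rewrite {1}(evensumE F) mulrDr; congr (_ + _).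
by rewrite mulr_sumr; apply: eq_bigr => c _; rewrite mulr_sumr.
Qed.

Lemma ler_evensum F G x : (forall y, F y <= G y) -> evensum F x <= evensum G x.
Proof.
move=> FG; move: x; apply: tree_ind => x IH; rewrite !evensumE.
apply: lerD => //; apply: ler_sum => c /ch_dep xc; apply: ler_sum => g /ch_dep cg.
by apply: IH; rewrite cg xc ltnW.
Qed.

Lemma evensum_ge0 F x : (forall y, 0 <= F y) -> 0 <= evensum F x.
Proof.
move=> F0; have := ler_evensum x F0; apply: le_trans.
have -> : evensum (fun=> 0) x = evensum (fun y => 0 * F y) x.
  by apply/eqP; rewrite eq_le !ler_evensum // => y; rewrite mul0r.
by rewrite evensumZ mul0r.
Qed.

Lemma altsum_unique F G :
  (forall x, G x + \sum_(c | ch x c) G c = F x) -> G =1 altsum F.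
Proof.
by move=> H; apply: tsum_unique => x; rewrite -H mulN1r addrK.
Qed.

Lemma altsumB F G x :
  altsum (fun y => F y - G y) x = altsum F x - altsum G x.
Proof.
apply/esym; move: x; apply: (altsum_unique (G := fun x => altsum F x - altsum G x)).
by move=> x; rewrite sumrB [altsum F x]altsumE [altsum G x]altsumE; ring.
Qed.

Lemma sum_children (G : 'I_n -> R) :
  \sum_x \sum_(c | ch x c) G c = \sum_(c | c != rt) G c.
Proof.
rewrite (exchange_big_dep (fun c => c != rt)) /=; last by move=> x c _ /andP[].
apply: eq_bigr => c cn; rewrite (bigD1 (par c)) /is_child ?cn ?eqxx //=.
by rewrite big1 ?addr0 // => x /andP[/eqP-> /eqP].
Qed.

(** When [subsumE] is summed over all nodes, every subtree sum except the root's occurs once on each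
    side and cancels. *)
Lemma subsum_root F : subsum F rt = \sum_y F y.
Proof.
have : \sum_x subsum F x = \sum_y F y + \sum_(c | c != rt) subsum F c.
  by rewrite -sum_children -big_split; apply: eq_bigr => x _; rewrite subsumE.
by rewrite (bigD1 rt) //= => /addIr.
Qed.

Section Nonneg.
Variable F : 'I_n -> R.
Hypothesis F0 : forall y, 0 <= F y.

Lemma subsum_ge0 x : 0 <= subsum F x.
Proof.
by rewrite subsum_evensum addr_ge0 ?sumr_ge0 // => *; apply: evensum_ge0.
Qed.

Lemma evensum_le_subsum x : evensum F x <= subsum F x.
Proof.
by rewrite subsum_evensum lerDl sumr_ge0 // => *; apply: evensum_ge0.
Qed.

Lemma subsum_le_total x : subsum F x <= \sum_y F y.
Proof.
rewrite -subsum_root; move: {2}(dep x) (leqnn (dep x)) => k.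
elim: k x => [|k IH] x hx; have [->//|xn] := eqVneq x rt; have xd := dep_par xn.
  by move: hx; rewrite xd.
apply: (@le_trans _ _ (subsum F (par x))); last first.
  by apply: IH; rewrite -ltnS -xd.
rewrite (subsumE _ (par x)) (bigD1 x) /is_child ?xn ?eqxx //=.
rewrite addrCA lerDl addr_ge0 // sumr_ge0 // => *; exact: subsum_ge0.
Qed.

End Nonneg.

(* [eta] is the slack given to each of the at most n nodes of the even part of
   a subtree, out of the drift [- altsum lam x] of the node x itself. *)
Lemma evensum_step (lam L L' : 'I_n -> R) (a : 'I_n) (eta : R) x :
  0 <= eta -> n%:R * eta <= altsum lam x ->
  (forall y, L y + (- ((a == y)%:R - \sum_(c | ch y c) (a == c)%:R)
               + (lam y - \sum_(c | ch y c) lam c) - eta) <= L' y) ->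
  evensum L x - altsum (fun y => (a == y)%:R) x <= evensum L' x.
Proof.
move=> eta0 le_eta HL; apply: le_trans (ler_evensum x HL).
rewrite evensumD lerD2l.
set one : 'I_n -> R := fun y => (a == y)%:R.
have -> : evensum (fun y => - ((a == y)%:R - \sum_(c | ch y c) (a == c)%:R)
               + (lam y - \sum_(c | ch y c) lam c) - eta) x
    = - altsum one x + altsum lam x - eta * evensum (fun=> 1) x.
  rewrite !altsum_evensum -[- evensum _ x]mulN1r -mulNr -!evensumZ -!evensumD.
  apply/eqP; rewrite eq_le; apply/andP; split; apply: ler_evensum => y;
  by rewrite mulN1r mulr1.
have le1 : evensum (fun=> 1 : R) x <= n%:R.
  apply: le_trans (evensum_le_subsum _ x) _ => //.
  apply: le_trans (subsum_le_total _ x) _ => //.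
  by rewrite sumr_const card_ord.
rewrite -addrA lerDl subr_ge0; apply: le_trans le_eta; rewrite mulrC.
by apply: ler_wpM2r.
Qed.

End TreeSums.

(** * Means over words of independent letters *)

Section Words.

Variables (n : nat) (R : realType) (lam : 'I_n -> R).

Definition word_mean (t : nat) (f : seq 'I_n -> R) : R :=
  \sum_(w : t.-tuple 'I_n) (\prod_(i <- w) lam i) * f w.

Lemma word_mean0 f : word_mean 0 f = f [::].
Proof.
rewrite /word_mean (bigD1 [tuple]) //= big_nil mul1r big1 ?addr0 // => w /eqP[].
exact: tuple0.
Qed.

Lemma word_meanS t f :
  word_mean t.+1 f = \sum_i lam i * word_mean t (fun w => f (i :: w)).
Proof.
rewrite /word_mean (reindex (fun p : 'I_n * t.-tuple 'I_n => [tuple of p.1 :: p.2])) /=.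
  rewrite -(pair_bigA _ (fun i (w : t.-tuple 'I_n) =>
    (\prod_(j <- i :: w) lam j) * f (i :: w))) /=.
  apply: eq_bigr => i _; rewrite mulr_sumr; apply: eq_bigr => w _.
  by rewrite big_cons mulrA.
exists (fun w : t.+1.-tuple 'I_n => (thead w, [tuple of behead w])) => [[i w]|w] _ /=.
  by congr (_, _); apply: val_inj.
by rewrite -tuple_eta.
Qed.

Lemma word_meanD t f g :
  word_mean t (fun w => f w + g w) = word_mean t f + word_mean t g.
Proof. by rewrite -big_split; apply: eq_bigr => w _; rewrite mulrDr. Qed.

Lemma word_meanZ t a f : word_mean t (fun w => a * f w) = a * word_mean t f.
Proof. by rewrite mulr_sumr; apply: eq_bigr => w _; rewrite mulrCA. Qed.

Lemma word_mean_sum t (I : finType) (f : I -> seq 'I_n -> R) :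
  word_mean t (fun w => \sum_i f i w) = \sum_i word_mean t (f i).
Proof.
by rewrite /word_mean exchange_big; apply: eq_bigr => w _; rewrite mulr_sumr.
Qed.

Hypothesis lam_ge0 : forall i, 0 <= lam i.

Lemma ler_word_mean t f g :
  (forall w, size w = t -> f w <= g w) -> word_mean t f <= word_mean t g.
Proof.
move=> fg; apply: ler_sum => w _; apply: ler_wpM2l; first exact: prodr_ge0.
by apply: fg; rewrite size_tuple.
Qed.

(** * Kingman's moment bound for a walk reflected at 0 *)

Section Lindley.

Variable xi : 'I_n -> R.

Definition lindley_step (x : R) (i : 'I_n) : R := Num.max 0 (x + xi i).

Definition lindley (w : seq 'I_n) : R := foldl lindley_step 0 w.

Lemma lindley_ge0 w : 0 <= lindley w.
Proof.
rewrite /lindley; case/lastP: w => [|w i] //=.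
by rewrite foldl_rcons le_max lexx.
Qed.

(** The starting point is arbitrary because [word_meanS] splits off the first letter, after which
    the walk has moved. *)
Let mean t (g : R -> R) x := word_mean t (fun w => g (foldl lindley_step x w)).

Let mean0 g x : mean 0 g x = g x.
Proof. by rewrite /mean word_mean0. Qed.

Let meanS t g x : mean t.+1 g x = \sum_i lam i * mean t g (lindley_step x i).
Proof. exact: word_meanS. Qed.

Hypothesis lam1 : \sum_i lam i = 1.

(* Starting from 0, the first step can only push the walk upwards. *)
Let mean_nondecreasing t : mean t id 0 <= mean t.+1 id 0.
Proof.
have mono k x y : x <= y -> mean k id x <= mean k id y.
  elim: k x y => [|k IH] x y xy; first by rewrite !mean0.
  rewrite !meanS; apply: ler_sum => i _; apply: ler_wpM2l => //; apply: IH.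
  by rewrite /lindley_step ge_max !le_max lexx lerD2r xy orbT.
rewrite meanS -[leLHS]mul1r -lam1 mulr_suml; apply: ler_sum => i _.
by apply: ler_wpM2l => //; apply: mono; rewrite le_max lexx.
Qed.

Variables eta v : R.
Hypothesis eta_gt0 : 0 < eta.
Hypothesis xi_mean : \sum_i lam i * xi i = - eta.
Hypothesis xi_var : \sum_i lam i * xi i ^+ 2 <= v.

(** Reflection does not increase the square of [x + xi i], whose mean is at most
    [x ^+ 2 - 2 * eta * x + v]. Conditioning on the first letter carries this one-step drift to
    every later period. *)
Let mean_sqr_drift t x : 0 <= x ->
  mean t.+1 (fun y => y ^+ 2) x + (2 * eta) * mean t id x <=
  mean t (fun y => y ^+ 2) x + v.
Proof.
elim: t x => [|t IH] x x0.
  rewrite meanS !mean0 /=.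
  have -> : x ^+ 2 + v = \sum_i lam i * x ^+ 2 + v by rewrite -mulr_suml lam1 mul1r.
  have -> : 2 * eta * x = - \sum_i lam i * (2 * (xi i * x)).
    rewrite (eq_bigr (fun i => (lam i * xi i) * (2 * x))); last by move=> i _; ring.
    by rewrite -mulr_suml xi_mean; ring.
  rewrite lerBlDr -addrA; apply: (@le_trans _ _ (\sum_i lam i * (x ^+ 2 + (xi i ^+ 2 + 2 * (xi i * x))))).
    apply: ler_sum => i _; rewrite mean0; apply: ler_wpM2l => //.
    rewrite /lindley_step; case: (lerP 0 (x + xi i)) => h; first by nra.
    have := sqr_ge0 (x + xi i); nra.
  rewrite (eq_bigr (fun i => lam i * x ^+ 2 + (lam i * xi i ^+ 2 + lam i * (2 * (xi i * x))))).
    by rewrite !big_split /= lerD2l lerD2r.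
  by move=> i _; rewrite !mulrDr.
rewrite (meanS t.+1 _ x) (meanS t id x) (meanS t _ x).
rewrite mulr_sumr -big_split /=.
have -> : v = \sum_i lam i * v by rewrite -mulr_suml lam1 mul1r.
rewrite -big_split; apply: ler_sum => i _ /=.
rewrite mulrCA -!mulrDr; apply: ler_wpM2l => //.
by apply: IH; rewrite le_max lexx.
Qed.

(** If the mean exceeded the bound at time [t], it would do so at all later times by monotonicity.
    The second moment would then fall by at least [gap] per period and become negative. *)
Lemma lindley_mean t : word_mean t lindley <= v / (2 * eta).
Proof.
rewrite -[word_mean t lindley]/(mean t id 0) ler_pdivlMr ?mulr_gt0 //.
rewrite leNgt; apply/negP => vlt.
set gap := mean t id 0 * (2 * eta) - v.
have gap0 : 0 < gap by rewrite subr_gt0.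
pose sq := fun y : R => y ^+ 2.
have bd k : mean (t + k) sq 0 + gap * k%:R <= mean t sq 0.
  elim: k => [|k IH]; first by rewrite addn0 mulr0 addr0.
  have h1 := mean_sqr_drift (t + k) (lexx 0).
  have h2 : mean t id 0 <= mean (t + k) id 0.
    elim: (k) => [|j]; first by rewrite addn0.
    by move/le_trans; apply; rewrite addnS; apply: mean_nondecreasing.
  have h3 : mean t id 0 * (2 * eta) <= 2 * eta * mean (t + k) id 0.
    by rewrite mulrC; apply: ler_wpM2l => //; rewrite mulr_ge0 // ltW.
  rewrite addnS -natr1 mulrDr mulr1; rewrite -/sq in h1; rewrite /gap in IH *; lra.
have [k hk] : exists k : nat, mean t sq 0 / gap < k%:R.
  exists (Num.bound `|mean t sq 0 / gap|).
  by apply: le_lt_trans (ler_norm _) _; apply: archi_boundP.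
have sq0 : 0 <= mean (t + k) sq 0.
  by apply: sumr_ge0 => w _; rewrite mulr_ge0 ?prodr_ge0 // sqr_ge0.
move: hk; rewrite ltr_pdivrMr // mulrC.
by have := bd k; lra.
Qed.

End Lindley.
End Words.

(** * From the probability space to finite words *)

Section WordExpectation.

Local Open Scope classical_set_scope.

Variables (n : nat) (R : realType) (lam : 'I_n -> R).
Variables (d : measure_display) (Omega : measurableType d).
Variables (P : probability Omega R) (X : nat -> Omega -> 'I_n).
Hypothesis HX : arrival_process P lam X.

Let cyl t (w : t.-tuple 'I_n) : set Omega :=
  [set om | mkseq (X ^~ om) t = w].

(** The default of [nth] is the bound variable itself, as no element of ['I_n] is at hand without an
    outcome. It is irrelevant for [k < t]. *)
Let cylE t (w : t.-tuple 'I_n) : 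
  cyl w = \bigcap_(k in [set` iota 0 t]) (X k @^-1` [set x | nth x w k = x]).
Proof.
apply/seteqP; split => om /=.
  move=> H k /=; rewrite mem_iota add0n => /andP[_ kt].
  by rewrite -H nth_mkseq.
move=> H; rewrite /cyl /=; case: (posnP t) => [t0|t0].
  by subst t; rewrite tuple0.
apply: (@eq_from_nth _ (X 0%N om)); first by rewrite size_mkseq size_tuple.
rewrite size_mkseq => k kt; rewrite nth_mkseq //.
have := H k; rewrite /= mem_iota add0n kt => /(_ isT) <-.
by apply: set_nth_default; rewrite size_tuple.
Qed.

Let preE t (w : t.-tuple 'I_n) k : (k < t)%N ->
  forall x0, X k @^-1` [set x | nth x w k = x] = X k @^-1` [set nth x0 w k].
Proof.
move=> kt x0; apply/seteqP; split => om /= H.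
  by rewrite -H; apply: set_nth_default; rewrite size_tuple.
by rewrite H; apply: set_nth_default; rewrite size_tuple.
Qed.

Let measurable_cyl t (w : t.-tuple 'I_n) : measurable (cyl w).
Proof.
have [mX _ _] := HX; rewrite cylE.
apply: bigcap_measurableType => k /=; rewrite mem_iota add0n => /andP[_ kt].
rewrite (preE w kt (tnth w (Ordinal kt))); exact: mX.
Qed.

Let P_cyl t (w : t.-tuple 'I_n) : P (cyl w) = (\prod_(i <- w) lam i)%:E.
Proof.
have [_ PX iX] := HX; rewrite cylE iX ?iota_uniq // -prodEFin.
case: t w => [|t] w; first by rewrite tuple0 /= !big_nil.
rewrite (big_nth (thead w)) size_tuple big_mkord.
rewrite -{1}[t.+1]subn0 -/(index_iota 0 t.+1) big_mkord.
by apply: eq_bigr => k _; rewrite (preE w (ltn_ord k) (thead w)) PX.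
Qed.

(** The integrand is a finite combination of indicators of cylinders, and independence gives the
    probability of each cylinder. *)
Lemma expectation_word t (f : seq 'I_n -> R) :
  'E_P[fun om => f (mkseq (X ^~ om) t)]%E = (word_mean lam t f)%:E.
Proof.
rewrite unlock.
transitivity (\int[P]_om (\sum_(w : t.-tuple 'I_n) (f w)%:E * (\1_(cyl w) om)%:E))%E.
  apply: eq_integral => om _.
  have szw : size (mkseq (X ^~ om) t) == t by rewrite size_mkseq.
  rewrite (bigD1 (Tuple szw)) //= indicE mem_set //= mule1.
  rewrite big1 ?adde0 // => w /eqP nw; rewrite indicE memNset ?mule0 //.
  by move=> /= H; apply: nw; apply: val_inj; rewrite /= H.
rewrite integral_sum //; last first.
  move=> w; apply: integrableZl => //.
  by apply: integrable_indic.
rewrite /word_mean -sumEFin; apply: eq_bigr => w _.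
rewrite integralZl //; last by apply: integrable_indic.
rewrite integral_indic // classical_sets.setIT EFinM muleC.
by congr (_ * _)%E; apply: P_cyl.
Qed.

End WordExpectation.

(** * Breadth-first distances and the parent map *)

Section BreadthFirst.

Variables (n : nat) (mT : finType) (ends : mT -> {set 'I_n}).
Variables (E : {set mT}) (rt : 'I_n).

Local Notation dist := (gdist ends E rt).

Lemma gdist_le (p : seq 'I_n) :
  path (adj ends E) rt p -> (dist (last rt p) <= size p)%N.
Proof.
move=> pp; rewrite leqNgt /gdist; set a := (fun k : nat => _); apply/negP => lt.
have sn : (size p < n)%N.
  by apply: leq_trans lt _; rewrite -{2}[n](size_iota 0); apply: find_size.
have /negbT/negP : a (size p) = false.
  by have := before_find 0%N lt; rewrite nth_iota // add0n.
by apply; apply/existsP; exists (in_tuple p); rewrite pp /= eqxx.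
Qed.

(** A duplicate-free path has fewer than [n] edges, so the search in [iota 0 n] succeeds and the
    junk value is avoided. *)
Lemma gdist_path i : connect (adj ends E) rt i ->
  exists2 p, path (adj ends E) rt p & last rt p = i /\ size p = dist i.
Proof.
case/connectP => q qp ->; case/shortenP: qp => p pp up _.
have hs : (size p < n)%N.
  by have := card_uniqP up => /= <-; rewrite -[n in (_ <= n)%N]card_ord max_card.
set j := last rt p.
pose a k := [exists p : k.-tuple 'I_n, path (adj ends E) rt p && (last rt p == j)].
have ha : has a (iota 0 n).
  apply/hasP; exists (size p); first by rewrite mem_iota.
  by apply/existsP; exists (in_tuple p); rewrite pp /= eqxx.
have := nth_find 0%N ha; move: ha; rewrite has_find size_iota => lt.
rewrite nth_iota // add0n /a => /existsP[q' /andP[qp /eqP ql]].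
by exists q' => //; rewrite size_tuple.
Qed.

(** [x] is the last node but one on a shortest path to [i], so it is closer than [i]. Appending [i]
    to a shortest path to [x] gives the other inequality. *)
Lemma gdist_parent i : connect (adj ends E) rt i -> i != rt ->
  exists2 x, adj ends E x i & dist i = (dist x).+1.
Proof.
move=> ci ni; have [p pp [pl ps]] := gdist_path ci.
case/lastP: p => [|p y] in pp pl ps *; first by rewrite -pl eqxx in ni.
move: pp; rewrite rcons_path last_rcons in pl *; rewrite {y}pl in ps *.
case/andP=> pp pa; exists (last rt p) => //; apply/eqP.
rewrite size_rcons in ps; rewrite eqn_leq -{2}ps ltnS (gdist_le pp) andbT.
have cx : connect (adj ends E) rt (last rt p) by apply/connectP; exists p.
have [q qp [ql qs]] := gdist_path cx.
have := @gdist_le (rcons q i); rewrite last_rcons size_rcons qs; apply.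
by rewrite rcons_path qp ql.
Qed.

Hypothesis Econn : graph_connected ends E.
Hypothesis cardE : (#|E| < n)%N.

(* A connected graph with fewer edges than nodes is a tree: its edges are the
   n - 1 edges that lead from the nodes other than rt to their parents. *)
Lemma parent_edges (m0 : mT) :
  exists (par : 'I_n -> 'I_n) (pm : 'I_n -> mT),
    [/\ forall i, i != rt -> dist i = (dist (par i)).+1,
        forall i, i != rt -> ends (pm i) = [set i; par i],
        forall m, (m \in E) = [exists i, (i != rt) && (m == pm i)] &
        {in [pred i | i != rt] &, injective pm}].
Proof.
have pmE i : exists xm : 'I_n * option mT, i != rt ->
    dist i = (dist xm.1).+1 /\
    exists2 m, xm.2 = Some m & m \in E /\ ends m = [set i; xm.1].
  case: (eqVneq i rt) => [_|ni]; first by exists (rt, None).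
  have [x] := gdist_parent (Econn rt i) ni.
  case/existsP=> m /and3P[mE _ /eqP em] dx.
  by exists (x, Some m) => _; split => //; exists m => //; rewrite finset.setUC.
(* Choice needs a total function; [m0] only fills in the value at the root. *)
have /choice[f Hf] : forall i, exists xm : 'I_n * mT, i != rt ->
    [/\ dist i = (dist xm.1).+1, xm.2 \in E & ends xm.2 = [set i; xm.1]].
  move=> i; have [[x om] H] := pmE i.
  case: (eqVneq i rt) => [_|ni]; first by exists (rt, m0).
  by have [dx [m _ [mE em]]] := H ni; exists (x, m).
pose par i := (f i).1; pose pm i := (f i).2.
have dpar i : i != rt -> dist i = (dist (par i)).+1 by case/Hf.
have pmi i : i != rt -> pm i \in E by case/Hf.
have epm i : i != rt -> ends (pm i) = [set i; par i] by case/Hf.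
(* Two distinct nodes sharing an edge would be each other's parents, which the depths forbid. *)
have inj : {in [pred i | i != rt] &, injective pm}.
  move=> i j; rewrite !inE => ni nj eq.
  have := epm i ni; rewrite eq (epm j nj) => es.
  have : i \in [set j; par j] by rewrite es !inE eqxx.
  have : j \in [set i; par i] by rewrite -es !inE eqxx.
  rewrite !inE => /predU1P[->//|/eqP ji] /predU1P[//|/eqP ij].
  have := dpar i ni; have := dpar j nj; rewrite -ij -ji => -> /eqP.
  by rewrite -[X in X == _]addn0 -addn2 eqn_add2l.
exists par, pm; split => // m.
have sub : pm @: [set i | i != rt] \subset E.
  by apply/fintype.subsetP => m' /imsetP[i]; rewrite inE => ni ->; apply: pmi.
have cim : #|pm @: [set i | i != rt]| = n.-1.
  rewrite card_in_imset; last by move=> i j; rewrite !inE; apply: inj.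
  rewrite (_ : [set i | i != rt] = ~: [set rt]); last by apply/setP => i; rewrite !inE.
  by rewrite cardsC1 card_ord.
have -> : E = pm @: [set i | i != rt].
  apply/esym/eqP; rewrite eqEcard sub cim; move: cardE; case: (n) => //.
apply/imsetP/existsP => [[i]|[i /andP[ni /eqP ->]]]; last by exists i; rewrite ?inE.
by rewrite inE => ni ->; exists i; rewrite ni eqxx.
Qed.

End BreadthFirst.

(** Take the element with the most elements below it: anything above it would have these below it
    and the element itself as well. *)
Lemma exists_maximum (T : finType) (A : {set T}) (r : rel T) :
  {in A, irreflexive r} -> {in A & &, transitive r} ->
  {in A &, forall x y, x != y -> r x y || r y x} -> A != finset.set0 ->
  exists2 x, x \in A & forall y, y \in A -> y != x -> r x y.
Proof.
move=> irr tr tot /finset.set0Pn[x0 x0A].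
pose low x := [set y in A | r x y].
case: (@arg_maxnP _ x0 (mem A) (fun x => #|low x|) x0A) => x xA0 xmax.
have xA : x \in A := xA0.
exists x => // y yA yx; have /orP[ryx|//] := tot y x yA xA yx.
have /subset_leq_card : x |: low x \subset low y.
  apply/fintype.subsetP => u; rewrite !inE => /predU1P[->|/andP[uA rxu]].
    by rewrite xA.
  by rewrite uA (tr x y u).
by rewrite cardsU1 !inE irr // andbF ltnNge; have /= -> := xmax y yA.
Qed.

(** * The queues under the tree priority policy, path by path *)

Section Dynamics.

Variables (n : nat) (mT : finType) (ends : mT -> {set 'I_n}).
Variables (E : {set mT}) (rt : 'I_n) (TP : policy n mT).
Variables (par : 'I_n -> 'I_n) (pm : 'I_n -> mT).

Local Notation dep := (gdist ends E rt).
Local Notation ch := (is_child rt par).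

Hypothesis dep_par : forall i, i != rt -> dep i = (dep (par i)).+1.
Hypothesis ends_pm : forall i, i != rt -> ends (pm i) = [set i; par i].
Hypothesis edge_pm : forall m, (m \in E) = [exists i, (i != rt) && (m == pm i)].
Hypothesis pm_inj : {in [pred i | i != rt] &, injective pm}.
Hypothesis HTP : is_tree_priority ends E [set rt] rt TP.

Lemma par_neq i : i != rt -> par i != i.
Proof. by move=> ni; apply/eqP => H; have := dep_par ni; rewrite H; lia. Qed.

Lemma pm_edge i : i != rt -> pm i \in E.
Proof. by move=> ni; rewrite edge_pm; apply/existsP; exists i; rewrite ni eqxx. Qed.

Lemma ch_child x c : ch x c -> child_of ends E rt x c.
Proof.
case/andP=> cn /eqP <-; rewrite /child_of dep_par // eqxx andbT.
apply/existsP; exists (pm c).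
by rewrite pm_edge // ends_pm // finset.setUC eqxx par_neq.
Qed.

(** Besides the new state, each case records which neighbouring queues were empty or not. This is
    all that later arguments use of the priorities. *)
Inductive tree_step (i : 'I_n) (x x' : state n mT) : Prop :=
| MatchChild c of ch i c & (0 < x.1 c)%N
    & (forall j, x'.1 j = x.1 j - (j == c))%N
    & (forall m, x'.2 m = x.2 m + (m == pm c))%N
| MatchParent of i != rt & (0 < x.1 (par i))%N
    & (forall c, ch i c -> x.1 c = 0%N)
    & (forall j, x'.1 j = x.1 j - (j == par i))%N
    & (forall m, x'.2 m = x.2 m + (m == pm i))%N
| Wait of (forall c, ch i c -> x.1 c = 0%N)
    & (i != rt -> x.1 (par i) = 0%N)
    & (forall j, x'.1 j = x.1 j + ((j == i) && (i != rt)))%N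
    & (forall m, x'.2 m = x.2 m).

Lemma available_child (x : {ffun 'I_n -> nat}) i c :
  ch i c -> (0 < x c)%N -> pm c \in available ends TP x i.
Proof.
case: HTP => _ HM _ _ /andP[cn /eqP ci] xc; subst i.
rewrite !inE HM inE pm_edge // ends_pm // !inE eqxx orbT /=.
by apply/existsP; exists c; rewrite finset.setUC eqxx xc eq_sym par_neq.
Qed.

Lemma available_parent (x : {ffun 'I_n -> nat}) i :
  i != rt -> (0 < x (par i))%N -> pm i \in available ends TP x i.
Proof.
case: HTP => _ HM _ _ ni xp.
rewrite !inE HM inE pm_edge // ends_pm // !inE eqxx /=.
by apply/existsP; exists (par i); rewrite eqxx xp par_neq.
Qed.

Lemma availableP (x : {ffun 'I_n -> nat}) i m : m \in available ends TP x i ->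
  (exists2 c, ch i c & (0 < x c)%N /\ m = pm c) \/
  [/\ i != rt, (0 < x (par i))%N & m = pm i].
Proof.
case: HTP => _ HM _ _; rewrite inE HM inE edge_pm.
case/andP=> /andP[/existsP[k /andP[kn /eqP ->]]]; rewrite ends_pm // => ik.
case/existsP=> j /andP[/andP[ji /eqP ee] xj].
have jk : j \in [set k; par k] by rewrite ee !inE eqxx orbT.
have [eik|nik] := eqVneq i k.
  right; subst k; move: jk; rewrite !inE (negPf ji) /= => /eqP jp.
  by rewrite -jp.
left; exists k => //.
  by move: ik; rewrite !inE (negPf nik) /= => /eqP ->; rewrite /is_child kn eqxx.
split=> //; move: ik jk; rewrite !inE (negPf nik) /= => /eqP ip.
by rewrite -ip (negPf ji) orbF => /eqP <-.
Qed.

Lemma stepP x i : tree_step i x (step ends TP x i).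
Proof.
case: (HTP) => Hsp HM Htr Hpr.
have [Hsub Hirr Htrans Htot] := Hsp i.
have avsub m : m \in available ends TP x.1 i -> m \in pol_matches TP i.
  by rewrite inE => /andP[].
rewrite /step /choose_match; case: pickP => [m /andP[mA /forallP mbest]|Hnone].
  case: (availableP mA) => [[c ic [xc em]]|[ni xp em]].
    have [cn /eqP pc] := andP ic.
    apply: (MatchChild ic xc) => [j|m'] /=; rewrite ffunE em //.
    rewrite ends_pm // !inE pc; congr (_ - nat_of_bool _)%N.
    have [->|] := eqVneq j i; last by rewrite orbF.
    by rewrite -pc (negPf (par_neq cn)).
  (* The match with a waiting child would be available. It has priority over the parent's match,
     which was chosen as best, so by transitivity it would precede itself. *)
  have nochild c : ch i c -> x.1 c = 0%N.
    move=> ic; apply/eqP; rewrite -leqn0 leqNgt; apply/negP => xc.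
    have cA := available_child ic xc.
    have [cn /eqP pc] := andP ic.
    have cm : pm c != pm i.
      by apply/eqP => /(pm_inj cn ni) ci; have := par_neq cn; rewrite pc ci eqxx.
    have := mbest (pm c); rewrite cA em cm /= => r1.
    have r2 : pol_prio TP i (pm c) (pm i).
      apply: (Hpr i c (par i)); rewrite ?pm_edge ?ends_pm ?inE //.
      - exact: ch_child.
      - by apply: ch_child; rewrite /is_child ni eqxx.
      - by rewrite pc finset.setUC.
    have := Hirr _ (avsub _ cA).
    by rewrite (Htrans _ _ _ (avsub _ _) (avsub _ cA) (avsub _ cA) r2 r1) // -em.
  apply: (MatchParent ni xp nochild) => [j|m'] /=; rewrite ffunE em //.
  rewrite ends_pm // !inE; congr (_ - nat_of_bool _)%N.
  by have [->|] := eqVneq j i; rewrite //= eq_sym (negPf (par_neq ni)).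
(* A nonempty set of available matches has a maximum, which [pick] would have found. *)
have noav : available ends TP x.1 i = finset.set0.
  apply/eqP/negPn/negP => /(exists_maximum (r := pol_prio TP i)).
  case=> [m mA|m1 m2 m3 A1 A2 A3|m1 m2 A1 A2|m mA mbest].
  - exact: Hirr (avsub _ mA).
  - by apply: Htrans; apply: avsub.
  - by apply: Htot; apply: avsub.
  have := Hnone m; rewrite mA /= => /negbT/negP; apply.
  by apply/forallP => m'; apply/implyP => m'A; apply/implyP; apply: mbest.
apply: Wait => [c ic|ni|j|m] //=.
- apply/eqP; rewrite -leqn0 leqNgt; apply/negP => xc.
  by have := available_child ic xc; rewrite noav inE.
- apply/eqP; rewrite -leqn0 leqNgt; apply/negP => xp.
  by have := available_parent ni xp; rewrite noav inE.
- by rewrite ffunE Htr inE.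
Qed.

Section Run.

Variable a : nat -> 'I_n.

Local Notation Q t := (run ends TP a t).1.
Local Notation D t := (run ends TP a t).2.

(** A queue grows only when the arriving type finds the queues of its parent and of all its children
    empty. *)
Lemma queue_complementary t c : c != rt -> Q t c = 0%N \/ Q t (par c) = 0%N.
Proof.
elim: t c => [|t IH] c cn /=; first by left; rewrite ffunE.
have IHc := IH c cn.
case: (stepP (run ends TP a t) (a t)) => [b _ _ HQ _|_ _ _ HQ _|H1 H2 HQ _];
  rewrite !HQ; try by case: IHc => ->; [left|right].
have [an|] := boolP (a t != rt); last by rewrite !andbF !addn0.
rewrite !andbT; have [ec|nc] := eqVneq c (a t).
  by right; rewrite ec H2 // (negPf (par_neq an)).
have [ep|np] := eqVneq (par c) (a t); last by rewrite !addn0.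
by left; rewrite H1 // /is_child cn ep eqxx.
Qed.

Lemma performed_outside t m : m \notin E -> D t m = 0%N.
Proof.
move=> mE; elim: t => [|t IH] /=; first by rewrite ffunE.
case: (stepP (run ends TP a t) (a t)) => [c|ni|] => [/andP[cn _] _ _|_ _ _|_ _ _] ->;
  rewrite IH //; case: eqVneq => // em; move: mE;
  by rewrite em pm_edge.
Qed.

Lemma arrivalsS t i : arrivals a t.+1 i = (arrivals a t i + (a t == i))%N.
Proof. by rewrite /arrivals big_ord_recr. Qed.

Lemma sum_pm_eq x c : c != rt ->
  (\sum_(b | ch x b) (pm b == pm c) = (par c == x))%N.
Proof.
move=> cn; rewrite (eq_bigr (fun b => nat_of_bool (b == c))); last first.
  move=> b /andP[bn _]; congr nat_of_bool; apply/eqP/eqP => [|->//].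
  exact: pm_inj.
case: (boolP (ch x c)) => [xc|xc].
  rewrite (bigD1 c) //= eqxx big1; first by case/andP: xc => _ ->.
  by move=> b /andP[_ /negPf ->].
rewrite big1; last by move=> b xb; case: eqVneq => // bc; rewrite bc (negPf xc) in xb.
by move: xc; rewrite /is_child cn /= => /negPf ->.
Qed.

(** The root is excluded because its unmatched agents are discarded. *)
Lemma conservation t i : i != rt ->
  (arrivals a t i = Q t i + D t (pm i) + \sum_(c | ch i c) D t (pm c))%N.
Proof.
move=> ni; elim: t => [|t IH].
  rewrite /arrivals big_ord0 /= !ffunE big1 // => c _; exact: ffunE.
rewrite arrivalsS IH /=.
case: (stepP (run ends TP a t) (a t)) => [c ac Qc HQ HD|an Qp _ HQ HD|_ _ HQ HD];
  rewrite HQ HD (eq_bigr _ (fun b _ => HD (pm b))) ?big_split /=.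
- have [cn /eqP pc] := andP ac; rewrite sum_pm_eq // pc.
  have -> : (pm i == pm c) = (i == c) by apply/eqP/eqP => [|->//]; apply: pm_inj.
  move: Qc; case: (eqVneq i c) => [->|_] Qc; last by lia.
  by have := par_neq cn; rewrite pc => /negPf ->; lia.
- rewrite sum_pm_eq //.
  have -> : (pm i == pm (a t)) = (i == a t) by apply/eqP/eqP => [|->//]; apply: pm_inj.
  move: Qp; rewrite (eq_sym i (par _)) (eq_sym i).
  case: (eqVneq (a t) i) => [<-|_] Qp; first by rewrite (negPf (par_neq an)); lia.
  by case: eqVneq => [<-|_]; lia.
rewrite (eq_sym i); case: eqVneq => [->|_]; rewrite ?ni; lia.
Qed.

Definition child_queue t x : nat := (\sum_(c | ch x c) Q t c)%N.

(* When children of x wait after period t.+1, all that happened at x in that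
   period is that x arrived and was matched with a child. *)
Lemma balance_step t x : (0 < child_queue t.+1 x)%N ->
  (\sum_(c | ch x c) D t.+1 (pm c) =
   \sum_(c | ch x c) D t (pm c) + (a t == x))%N.
Proof.
rewrite /child_queue /=.
case: (stepP (run ends TP a t) (a t)) => [c ac Qc HQ HD|an Qp H0 HQ HD|H0 H1 HQ HD];
  rewrite (eq_bigr _ (fun b _ => HD (pm b))) (eq_bigr _ (fun b _ => HQ b)) ?big_split /=.
- by have [cn /eqP pc] := andP ac; rewrite sum_pm_eq // pc.
(* If [x] is the parent just matched, it had agents waiting, so its children had none by
   complementarity. If [x] is the arriving type, it prefers its children, so again none waited. Both
   contradict [Hpos]. *)
- rewrite sum_pm_eq // => Hpos; suff [-> ->] : par (a t) == x = false /\ a t == x = false by [].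
  split; apply/negP => /eqP ex; move: Hpos; rewrite big1 // => c xc.
    have [cn /eqP pc] := andP xc.
    case: (queue_complementary t cn) => [->//|]; rewrite pc -ex => Q0.
    by rewrite Q0 in Qp.
  by rewrite H0 // ex.
move=> Hpos; case: eqVneq => [ex|]; last by rewrite addn0.
subst x; rewrite -big_split big1 // in Hpos => c xc /=.
have [cn /eqP pc] := andP xc; rewrite H0 //; case: eqVneq => // ec.
by have := par_neq cn; rewrite pc ec eqxx.
Qed.

End Run.
End Dynamics.

(** * Domination of the queues by reflected walks *)

Section QueueBound.

Variables (R : realType) (n : nat) (mT : finType) (ends : mT -> {set 'I_n}).
Variables (E : {set mT}) (rt : 'I_n) (TP : policy n mT).
Variables (par : 'I_n -> 'I_n) (pm : 'I_n -> mT).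

Local Notation dep := (gdist ends E rt).
Local Notation ch := (is_child rt par).

Hypothesis dep_par : forall i, i != rt -> dep i = (dep (par i)).+1.
Hypothesis ends_pm : forall i, i != rt -> ends (pm i) = [set i; par i].
Hypothesis edge_pm : forall m, (m \in E) = [exists i, (i != rt) && (m == pm i)].
Hypothesis pm_inj : {in [pred i | i != rt] &, injective pm}.
Hypothesis HTP : is_tree_priority ends E [set rt] rt TP.

Local Notation altsum := (@altsum n R rt par dep).
Local Notation evensum := (@evensum n R rt par dep).
Local Notation subsum := (@subsum n R rt par dep).

Variables (lam : 'I_n -> R) (eta : R).
Hypothesis lam_ge0 : forall i, 0 <= lam i.
Hypothesis lam1 : \sum_i lam i = 1.
Hypothesis eta_gt0 : 0 < eta.
Hypothesis le_eta : forall x, n%:R * eta <= altsum lam x.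

Definition node_incr (y i : 'I_n) : R :=
  - ((i == y)%:R - \sum_(c | ch y c) (i == c)%:R)
  + (lam y - \sum_(c | ch y c) lam c) - eta.

Definition node_walk (w : seq 'I_n) (y : 'I_n) : R := lindley (node_incr y) w.

Section Path.

Variable a : nat -> 'I_n.

Local Notation Q t := (run ends TP a t).1.
Local Notation D t := (run ends TP a t).2.
Local Notation walk t := (node_walk (mkseq a t)).

Definition alt_arrivals t x : R := altsum (fun y => (arrivals a t y)%:R) x.

Definition excess t x : R :=
  (arrivals a t x)%:R - (\sum_(c | ch x c) D t (pm c))%:R - alt_arrivals t x.

(** The recursion of [altsum] cancels the alternating sums, and conservation at each child leaves
    its queue. *)
Lemma child_queue_excess t x :
  (child_queue ends rt TP par a t x)%:R =
  excess t x + \sum_(c | ch x c) excess t c.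
Proof.
rewrite /excess /child_queue !sumrB [alt_arrivals t x](altsumE dep_par).
rewrite natr_sum (eq_bigr (fun c => (arrivals a t c)%:R - (D t (pm c))%:R -
  (\sum_(g | ch c g) D t (pm g))%:R)); last first.
  move=> c /andP[cn _].
  by rewrite (conservation dep_par ends_pm edge_pm pm_inj HTP a t cn) !natrD; ring.
rewrite !sumrB natr_sum -/(alt_arrivals t); ring.
Qed.

Lemma node_walk_ge0 w y : 0 <= node_walk w y.
Proof. exact: lindley_ge0. Qed.

(** By [balance_step] the arrivals at [x] and its matches with children change equally, so only
    [alt_arrivals] moves the excess. *)
Lemma excess_step t x : (0 < child_queue ends rt TP par a t.+1 x)%N ->
  excess t.+1 x = excess t x - altsum (fun y => (a t == y)%:R) x.
Proof.
move=> H.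
rewrite /excess (balance_step dep_par ends_pm edge_pm pm_inj HTP H) arrivalsS.
have -> : alt_arrivals t.+1 x =
    alt_arrivals t x + altsum (fun y => (a t == y)%:R) x.
  apply/eqP; rewrite addrC -subr_eq; apply/eqP.
  rewrite /alt_arrivals -(altsumB dep_par); congr (altsum _ _).
  by apply: funext => y; rewrite arrivalsS natrD addrC addKr.
by rewrite !natrD; ring.
Qed.

(** Induction over time and, within a period, from the leaves upwards. Waiting children call for the
    bound of the previous period, their absence for that of the grandchildren. *)
Lemma excess_le_evensum t x : excess t x <= evensum (walk t) x.
Proof.
(* Here the excess of [v] is minus the sum of those of its children [c]. As the child queue of [c]
   is nonnegative, minus the excess of [c] is at most the sum of the excesses of the children of
   [c]. *)
have balanced u v : child_queue ends rt TP par a u v = 0%N ->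
    (forall y, (dep v < dep y)%N -> excess u y <= evensum (walk u) y) ->
    excess u v <= evensum (walk u) v.
  move=> C0 IH; have := child_queue_excess u v; rewrite C0 => /esym/eqP.
  rewrite addr_eq0 => /eqP ->; rewrite (evensumE dep_par) -sumrN.
  rewrite -[leLHS]add0r; apply: lerD; first exact: node_walk_ge0.
  apply: ler_sum => c vc; have := ch_dep dep_par vc => dc.
  apply: (@le_trans _ _ (\sum_(g | ch c g) excess u g)).
    by have := child_queue_excess u c; have := ler0n R (child_queue ends rt TP par a u c); lra.
  by apply: ler_sum => g /(ch_dep dep_par) dg; apply: IH; rewrite dg dc ltnW.
elim: t x => [|t IHt]; apply: (tree_ind (dep := dep)) => x IHx.
  apply: balanced => //; rewrite /child_queue big1 // => c _.
  by rewrite /= ffunE.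
case: (posnP (child_queue ends rt TP par a t.+1 x)) => C0; first exact: balanced.
have := IHt x; rewrite excess_step //.
have := @evensum_step _ _ _ _ _ dep_par lam (walk t) (walk t.+1) (a t) eta x
  (ltW eta_gt0) (le_eta x).
move=> H1 H2; apply: le_trans (H1 _); first by rewrite lerD2r.
(* Reflection only raises the walk above its free step. *)
move=> y; rewrite /node_walk mkseqS /lindley foldl_rcons.
by rewrite le_max -/(lindley _ _) lexx orbT.
Qed.

(** The even sums at [x] and at its children add up to one subtree sum, which is at most the total;
    the factor [n] counts the nodes [x]. *)
Lemma queue_le_walks t :
  \sum_(i | i != rt) (Q t i)%:R <= n%:R * \sum_y walk t y.
Proof.
rewrite -(sum_children rt par (fun i => (Q t i)%:R)).
rewrite -[n in n%:R]card_ord -sumr_const mulr_suml; apply: ler_sum => x _.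
rewrite mul1r -natr_sum [leLHS]child_queue_excess.
apply: le_trans (subsum_le_total dep_par _ x); last by move=> y; apply: node_walk_ge0.
rewrite (subsum_evensum dep_par); apply: lerD; first exact: excess_le_evensum.
by apply: ler_sum => c _; apply: excess_le_evensum.
Qed.

End Path.

Lemma sum_ch_eq y i : \sum_(c | ch y c) (i == c)%:R = (ch y i)%:R :> R.
Proof.
case: (boolP (ch y i)) => h.
  rewrite (bigD1 i) //= eqxx big1 ?addr0 // => c /andP[_ ci].
  by rewrite eq_sym (negPf ci).
rewrite big1 // => c hc; case: eqVneq => // ic; by rewrite ic hc in h.
Qed.

Lemma sum_lam_eq y : \sum_i lam i * (i == y)%:R = lam y.
Proof.
rewrite (bigD1 y) //= eqxx mulr1 big1 ?addr0 // => i /negPf ->.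
by rewrite mulr0.
Qed.

Lemma sum_lam_ch y : \sum_i lam i * (ch y i)%:R = \sum_(c | ch y c) lam c.
Proof.
rewrite [RHS]big_mkcond; apply: eq_bigr => i _.
by case: (ch y i); rewrite ?mulr1 ?mulr0.
Qed.

Lemma node_incr_mean y : \sum_i lam i * node_incr y i = - eta.
Proof.
pose k := lam y - \sum_(c | ch y c) lam c - eta.
rewrite (eq_bigr (fun i => lam i * (ch y i)%:R - lam i * (i == y)%:R + lam i * k)).
  rewrite big_split sumrB /= sum_lam_eq sum_lam_ch -mulr_suml lam1 /k; ring.
by move=> i _; rewrite /node_incr sum_ch_eq /k; ring.
Qed.

Lemma node_incr_var y : \sum_i lam i * node_incr y i ^+ 2 <=
  lam y + \sum_(c | ch y c) lam c + eta ^+ 2.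
Proof.
set mu := lam y - \sum_(c | ch y c) lam c.
(* With [k = mu - eta] and increment [X = b + k], use [X^2 = b^2 + 2kX - k^2]. As [y] is not its own
   child, [b^2] is a sum of two indicators. The mean of [2kX - k^2] is [eta^2 - mu^2]. *)
rewrite (eq_bigr (fun i => lam i * (ch y i)%:R + lam i * (i == y)%:R +
  (2 * (mu - eta)) * (lam i * node_incr y i) - lam i * (mu - eta) ^+ 2)).
  rewrite sumrB !big_split /= sum_lam_eq sum_lam_ch -mulr_sumr node_incr_mean.
  rewrite -mulr_suml lam1; have := sqr_ge0 mu; nra.
move=> i _; rewrite /node_incr sum_ch_eq -/mu.
have : ch y i && (i == y) = false.
  by apply/negP => /andP[/(ch_dep dep_par) h /eqP ei]; rewrite ei in h; lia.
by case: (ch y i); case: (i == y) => //= _; ring.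
Qed.

Lemma mean_queue t :
  word_mean lam t (fun w => \sum_(i | i != rt) ((run ends TP (nth rt w) t).1 i)%:R)
  <= n%:R * ((2 + n%:R * eta ^+ 2) / (2 * eta)).
Proof.
apply: (@le_trans _ _ (word_mean lam t (fun w => n%:R * \sum_y node_walk w y))).
  apply: ler_word_mean => // w sw.
  have -> : node_walk w = node_walk (mkseq (nth rt w) t) by rewrite -sw mkseq_nth.
  exact: queue_le_walks.
rewrite word_meanZ word_mean_sum; apply: ler_wpM2l => //.
apply: (@le_trans _ _ (\sum_y (lam y + \sum_(c | ch y c) lam c + eta ^+ 2) / (2 * eta))).
  apply: ler_sum => y _; apply: lindley_mean => //.
    exact: node_incr_mean.
  exact: node_incr_var.
rewrite -mulr_suml; apply: ler_wpM2r; first by rewrite invr_ge0 mulr_ge0 // ltW.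
(* The constant 2 bounds the sum of [lam] over all nodes, which is 1, plus its sum over the nodes
   other than the root. *)
rewrite !big_split /= sum_children sumr_const card_ord lam1.
rewrite mulr_natl lerD2r -[2]/(1 + 1) lerD2l -lam1 [leRHS](bigD1 rt) //=.
by rewrite lerDr.
Qed.

End QueueBound.

(** * The GPG parameter *)

Section Eps.

Variables (R : realType) (n : nat) (mT : finType) (z : mT -> R) (s : 'I_n -> R).

Lemma gpg_eps_le v : 0 < spp_var z s v -> gpg_eps z s <= spp_var z s v.
Proof. by move=> v0; apply: ge_inf; [exists 0 => _ [? -> /ltW]|exists v]. Qed.

(** There are finitely many variables, so the infimum is attained; [v] shows that the set is
    nonempty. *)
Lemma gpg_eps_gt0 v : 0 < spp_var z s v -> 0 < gpg_eps z s.
Proof.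
move=> v0; have := arg_minP (P := fun v => 0 < spp_var z s v) (spp_var z s) v0.
case=> u u0 umin; apply: lt_le_trans u0 _; apply: lb_le_inf; first by exists (spp_var z s v), v.
by move=> _ [w -> w0]; apply: umin.
Qed.

End Eps.

(** * Dual prices from the optimal basis *)

Section Dual.

Variables (R : realType) (n : nat) (mT : finType) (ends : mT -> {set 'I_n}).
Variables (rew : mT -> R) (lam : 'I_n -> R) (z : mT -> R) (s : 'I_n -> R).

Local Notation col := (@spp_col n mT ends R).
Local Notation var := (spp_var z s).

(** Positive variables are basic, and one of the [n] basic variables is the slack of [rt]. *)
Lemma card_active_matches rt : nondegenerate_basic ends z s -> 0 < s rt ->
  (#|active_matches z| < n)%N.
Proof.
case=> b [_ b0 _] srt.
have inb v : 0 < var v -> v \in codom b.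
  move=> v0; apply/codomP/not_existsP => nb.
  by have := b0 v (fun k e => nb k (esym e)) => e; rewrite e ltxx in v0.
have inlI : injective (@inl mT 'I_n) by move=> ? ? [].
have sub : inr rt |: [set inl m | m in active_matches z] \subset codom b.
  apply/fintype.subsetP => v; rewrite !inE => /predU1P[->|]; first exact: inb.
  by case/imsetP => m; rewrite inE => m0 ->; apply: inb.
have := subset_leq_card sub; rewrite cardsU1 card_imset //.
have -> : inr rt \notin [set inl m | m in active_matches z].
  by apply/imsetP => -[].
move=> h; apply: leq_trans h _; rewrite -[n in (_ <= n)%N]card_ord.
exact: leq_image_card.
Qed.

Lemma spp_col_match m i : col (inl m) i 0 = (i \in ends m)%:R.
Proof. by rewrite mxE. Qed.

Lemma spp_col_slack j i : col (inr j) i 0 = (i == j)%:R.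
Proof. by rewrite mxE. Qed.

Lemma sum_spp_var (x c : mT + 'I_n -> R) :
  \sum_v x v * c v = \sum_m x (inl m) * c (inl m) + \sum_i x (inr i) * c (inr i).
Proof. by rewrite big_sumType. Qed.

Lemma sum_spp_col (x : mT + 'I_n -> R) i :
  \sum_v x v * col v i 0 = \sum_(m | i \in ends m) x (inl m) + x (inr i).
Proof.
rewrite sum_spp_var; congr (_ + _).
  rewrite [RHS]big_mkcond; apply: eq_bigr => m _; rewrite spp_col_match.
  by case: (i \in ends m); rewrite ?mulr1 ?mulr0.
rewrite (bigD1 i) //= spp_col_slack eqxx mulr1 big1 ?addr0 // => j /negPf ji.
by rewrite spp_col_slack eq_sym ji mulr0.
Qed.

Definition spp_cost (v : mT + 'I_n) : R := if v is inl m then rew m else 0.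

(* The prices are the multipliers of the optimal basis.  A column priced below
   its cost could be brought into the basis by a small amount, as the basic
   variables are positive, and this would improve the objective. *)
Lemma dual_prices : gpg_solution ends rew lam z s -> (exists v, 0 < var v) ->
  exists p : 'I_n -> R,
  [/\ forall i, 0 <= p i,
      forall m, rew m <= \sum_(i in ends m) p i,
      forall m, 0 < z m -> rew m = \sum_(i in ends m) p i &
      forall i, 0 < s i -> p i = 0].
Proof.
case=> [[[feq z0 s0] opt] [b [Bunit b0 bpos]]] [v0 v0pos].
set B := \matrix_(i, k) _ in Bunit.
pose c : 'rV[R]_n := \row_k spp_cost (b k).
pose p : 'rV[R]_n := c *m invmx B.
have pcol v : (p *m col v) 0 0 = \sum_i p 0 i * col v i 0 by rewrite mxE.
have pm m : (p *m col (inl m)) 0 0 = \sum_(i in ends m) p 0 i.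
  rewrite pcol [RHS]big_mkcond; apply: eq_bigr => i _; rewrite spp_col_match.
  by case: (i \in ends m); rewrite ?mulr1 ?mulr0.
have pi i : (p *m col (inr i)) 0 0 = p 0 i.
  rewrite pcol (bigD1 i) //= spp_col_slack eqxx mulr1 big1 ?addr0 // => j /negPf ji.
  by rewrite spp_col_slack ji mulr0.
have basic k : (p *m col (b k)) 0 0 = spp_cost (b k).
  transitivity ((p *m B) 0 k); last by rewrite -mulmxA mulVmx // mulmx1 mxE.
  by rewrite pcol [RHS]mxE; apply: eq_bigr => i _; rewrite [B _ _]mxE.
have active v : 0 < var v -> (p *m col v) 0 0 = spp_cost v.
  move=> vpos; have [[k <-]|nb] := pselect (exists k, b k = v); first exact: basic.
  have : var v = 0 by apply: b0 => k ek; apply: nb; exists k.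
  by move=> e; rewrite e ltxx in vpos.
have var0 v : 0 <= var v by case: v => /=.
have reduced v : spp_cost v <= (p *m col v) 0 0.
  pose u : 'cV[R]_n := invmx B *m col v.
  have Bu : B *m u = col v by rewrite mulmxA mulmxV // mul1mx.
  have cu : (p *m col v) 0 0 = \sum_k u k 0 * spp_cost (b k).
    by rewrite /p -mulmxA mxE; apply: eq_bigr => k _; rewrite mxE mulrC.
  have eps0 := gpg_eps_gt0 v0pos.
  have S0 : 0 <= \sum_k `|u k 0| by apply: sumr_ge0.
  (* The step is so short that no basic variable, being at least [gpg_eps z s], turns negative; the
     1 keeps the denominator positive. *)
  pose th := gpg_eps z s / (1 + \sum_k `|u k 0|).
  have th0 : 0 < th by apply: divr_gt0 => //; lra.
  (* Raise [v] by one unit and lower the basic variables by [u], which keeps the constraints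
     satisfied; [v] may itself be basic. *)
  pose dir w := (w == v)%:R - \sum_(k | b k == w) u k 0.
  pose x' w := var w + th * dir w.
  have sum_dir (f : mT + 'I_n -> R) :
      \sum_w dir w * f w = f v - \sum_k u k 0 * f (b k).
    rewrite (eq_bigr (fun w => (w == v)%:R * f w -
      \sum_(k | b k == w) u k 0 * f (b k))); last first.
      move=> w _; rewrite mulrBl mulr_suml; congr (_ - _).
      by apply: eq_bigr => k /eqP ->.
    rewrite sumrB (bigD1 v) //= eqxx mul1r big1 ?addr0; last first.
      by move=> w /negPf ->; rewrite mul0r.
    congr (_ - _).
    rewrite (exchange_big_dep xpredT) //=; apply: eq_bigr => k _.
    by rewrite (big_pred1 (b k)) // => w; rewrite /= eq_sym.
  have sum_x' f : \sum_w x' w * f w =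
      \sum_w var w * f w + th * (f v - \sum_k u k 0 * f (b k)).
    rewrite -sum_dir mulr_sumr -big_split; apply: eq_bigr => w _ /=.
    by rewrite mulrDl mulrA.
  have x'0 w : 0 <= x' w.
    have [[k bk]|nb] := pselect (exists k, b k = w); last first.
      rewrite /x' /dir big_pred0 ?subr0; last first.
        by move=> k; apply/eqP => ek; apply: nb; exists k.
      by rewrite addr_ge0 // mulr_ge0 // ltW.
    have le1 : gpg_eps z s <= var w by apply: gpg_eps_le; rewrite -bk.
    have le2 : \sum_(k | b k == w) u k 0 <= \sum_k `|u k 0|.
      rewrite big_mkcond; apply: ler_sum => j _.
      by case: ifP => _; rewrite ?ler_norm.
    have e : gpg_eps z s = th * (1 + \sum_k `|u k 0|).
      by rewrite /th divfK //; lra.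
    have : th * - dir w <= th * (1 + \sum_k `|u k 0|).
      apply: ler_wpM2l; first exact: ltW.
      have := ler0n R (w == v); rewrite /dir; lra.
    rewrite -e /x' mulrN; lra.
  have feas : spp_feasible ends lam (x' \o inl) (x' \o inr).
    split=> [i|m|i]; rewrite /= ?x'0 //.
    rewrite -sum_spp_col sum_x' sum_spp_col feq.
    have -> : \sum_k u k 0 * col (b k) i 0 = col v i 0.
      rewrite -Bu mxE; apply: eq_bigr => k _.
      by rewrite mulrC; congr (_ * _); rewrite [RHS]mxE.
    by rewrite subrr mulr0 addr0.
  have := opt _ _ feas.
  have cost x : \sum_m rew m * x (inl m) = \sum_v x v * spp_cost v.
    rewrite sum_spp_var [X in _ + X]big1 ?addr0; last by move=> i _; rewrite mulr0.
    by apply: eq_bigr => m _; rewrite mulrC.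
  rewrite [X in X <= _](cost x') sum_x' [X in _ <= X](cost var).
  rewrite gerDl pmulr_rle0 // subr_le0 cu; exact.
exists (fun i => p 0 i); split => [i|m|m m0|i i0].
- by rewrite -pi; apply: (reduced (inr i)).
- by rewrite -pm; apply: (reduced (inl m)).
- by rewrite -pm (active (inl m)).
- by rewrite -pi (active (inr i)).
Qed.

End Dual.

Lemma eq_run n (mT : finType) (ends : mT -> {set 'I_n}) (TP : policy n mT) (a b : nat -> 'I_n) t :
  (forall k, (k < t)%N -> a k = b k) -> run ends TP a t = run ends TP b t.
Proof.
elim: t => //= t IH ab; rewrite IH ?ab // => k kt.
by apply: ab; apply: ltnW.
Qed.

Lemma eq_arrivals n (a b : nat -> 'I_n) t :
  (forall k, (k < t)%N -> a k = b k) -> arrivals a t = arrivals b t.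
Proof.
by move=> ab; apply: funext => i; apply: eq_bigr => k _; rewrite ab.
Qed.

(** Weak duality: [p] is feasible for the dual of the matching program. *)
Lemma offline_value_le (R : realType) n (mT : finType) (ends : mT -> {set 'I_n})
    (rew : mT -> R) (p : 'I_n -> R) (A : 'I_n -> nat) :
  (forall i, 0 <= p i) -> (forall m, rew m <= \sum_(i in ends m) p i) ->
  offline_value ends rew A <= \sum_i p i * (A i)%:R.
Proof.
move=> p0 prew; apply: ge_sup.
  exists (\sum_m rew m * ([ffun=> 0%N] m)%:R), [ffun=> 0%N] => //= i.
  by rewrite big1 // => m _; rewrite ffunE.
move=> _ [y /= Hy <-].
apply: (@le_trans _ _ (\sum_m \sum_(i in ends m) p i * (y m)%:R)).
  by apply: ler_sum => m _; rewrite -mulr_suml; apply: ler_wpM2r.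
rewrite (exchange_big_dep xpredT) //=; apply: ler_sum => i _.
by rewrite -mulr_sumr -natr_sum; apply: ler_wpM2l => //; rewrite ler_nat.
Qed.

(** * Regret in terms of queues, and the final bound *)

Section Main.

Variables (R : realType) (n : nat) (mT : finType) (ends : mT -> {set 'I_n}).
Variables (rew : mT -> R) (lam : 'I_n -> R) (z : mT -> R) (s : 'I_n -> R).
Variables (rt : 'I_n) (TP : policy n mT) (par : 'I_n -> 'I_n) (pm : 'I_n -> mT).

Local Notation E := (active_matches z).
Local Notation dep := (gdist ends E rt).
Local Notation ch := (is_child rt par).

Hypothesis lam_gt0 : forall i, 0 < lam i.
Hypothesis lam1 : \sum_i lam i = 1.
Hypothesis Hgpg : gpg_solution ends rew lam z s.
Hypothesis Hunder : under_demanded s = [set rt].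
Hypothesis HTP : is_tree_priority ends E [set rt] rt TP.
Hypothesis dep_par : forall i, i != rt -> dep i = (dep (par i)).+1.
Hypothesis ends_pm : forall i, i != rt -> ends (pm i) = [set i; par i].
Hypothesis edge_pm : forall m, (m \in E) = [exists i, (i != rt) && (m == pm i)].
Hypothesis pm_inj : {in [pred i | i != rt] &, injective pm}.

Local Notation eps := (gpg_eps z s).

(** An edge at [x] leads to its parent or to a child. The general codomain serves both the flow [z]
    and the match counts. *)
Lemma sum_incident (V : nmodType) (f : mT -> V) x :
  (forall m, m \notin E -> f m = 0) ->
  \sum_(m | x \in ends m) f m =
  (if x == rt then 0 else f (pm x)) + \sum_(c | ch x c) f (pm c).
Proof.
move=> f0.
have EE : E = [set pm i | i in [pred i | i != rt]].
  apply/setP => m; rewrite edge_pm; apply/existsP/imsetP => [[i /andP[ni /eqP->]]|[i ni ->]].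
    by exists i.
  by exists i; rewrite eqxx andbT.
transitivity (\sum_(m in E) if x \in ends m then f m else 0).
  rewrite big_mkcond [RHS]big_mkcond; apply: eq_bigr => m _.
  by case: ifP => //; case: ifP => // mE _; rewrite f0 // mE.
rewrite EE big_imset //= -big_mkcondr /=.
rewrite (eq_bigl (fun i => (i != rt) && ((i == x) || (par i == x)))); last first.
  move=> i; rewrite inE; have [//|ni] := eqVneq i rt.
  by rewrite ends_pm // !inE (eq_sym x) (eq_sym x).
case: (eqVneq x rt) => [xr|xn].
  rewrite add0r; apply: eq_bigl => i; rewrite /is_child xr.
  by case: (eqVneq i rt).
rewrite (bigD1 x) /= ?xn ?eqxx //; congr (_ + _).
apply: eq_bigl => i; rewrite /is_child; case: (eqVneq i rt) => //= ni.
case: (eqVneq i x) => [->|] /=; last by rewrite andbT.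
by apply/esym/negbTE; apply: (par_neq dep_par).
Qed.

Let srt : 0 < s rt.
Proof. by have := set11 rt; rewrite -Hunder inE. Qed.

Let s0 x : x != rt -> s x = 0.
Proof.
case: Hgpg => -[[_ _ sge0] _ _] xn; apply/eqP; rewrite eq_le sge0 andbT leNgt.
have : x \notin under_demanded s by rewrite Hunder inE.
by rewrite inE.
Qed.

Let zE m : m \notin E -> z m = 0.
Proof.
case: Hgpg => -[[_ zge0 _] _ _] mE; apply/eqP; rewrite eq_le zge0 andbT leNgt.
by move: mE; rewrite inE.
Qed.

Let pmE i : i != rt -> 0 < z (pm i).
Proof. by move=> ni; have := pm_edge edge_pm ni; rewrite inE. Qed.

Lemma eps_gt0 : 0 < eps.
Proof. exact: (@gpg_eps_gt0 _ _ _ z s (inr rt)). Qed.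

(** The flow on the edge to the parent, or the slack at the root, solves the recursion of
    [altsum lam]; it is a positive variable of the program. *)
Lemma eps_le_altsum x : eps <= altsum rt par dep lam x.
Proof.
pose G x := if x == rt then s rt else z (pm x).
rewrite -(altsum_unique dep_par (G := G)).
  rewrite /G; case: eqVneq => xn; first exact: (gpg_eps_le (v := inr rt)).
  by apply: (gpg_eps_le (v := inl (pm x))); apply: pmE.
move=> {}x; case: Hgpg => -[[feq _ _] _ _]; rewrite -(feq x) sum_incident //.
rewrite (eq_bigr (fun c => z (pm c))).
  by rewrite /G; case: eqVneq => [->|/s0 ->]; rewrite ?add0r ?addr0 // addrC.
by move=> c /andP[cn _]; rewrite /G (negPf cn).
Qed.

Lemma eps_le1 : eps <= 1.
Proof.
case: Hgpg => -[[feq zge0 _] _ _].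
apply: le_trans (gpg_eps_le (v := inr rt) srt) _ => /=.
apply: (@le_trans _ _ (lam rt)).
  by rewrite -(feq rt) lerDr sumr_ge0.
by rewrite -lam1 (bigD1 rt) //= lerDl sumr_ge0 // => i _; apply: ltW.
Qed.

(** By complementary slackness the rewards earned are the prices of the matched agents, so the
    regret is at most the price of the waiting ones. The root has price 0, and [p i <= rew (pm i)]
    elsewhere. *)
Lemma regret_path_le a t :
  offline_value ends rew (arrivals a t) -
    \sum_m rew m * (performed ends TP a t m)%:R <=
  rew_max rew z * \sum_(i | i != rt) ((run ends TP a t).1 i)%:R.
Proof.
have [p [p0 prew pact pslack]] :=
  dual_prices Hgpg (ex_intro (fun v => 0 < spp_var z s v) (inr rt) srt).
set D := (run ends TP a t).2; set Q := (run ends TP a t).1.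
have Dout m : m \notin E -> D m = 0%N.
  by move=> mE; apply: (performed_outside dep_par ends_pm edge_pm pm_inj HTP).
have -> : \sum_m rew m * (performed ends TP a t m)%:R =
    \sum_i p i * (\sum_(m | i \in ends m) D m)%:R.
  transitivity (\sum_m \sum_(i in ends m) p i * (D m)%:R).
    apply: eq_bigr => m _; rewrite -mulr_suml /performed -/D.
    have [mE|mE] := boolP (m \in E); last by rewrite Dout // !mulr0.
    by rewrite -pact //; move: mE; rewrite inE.
  rewrite (exchange_big_dep xpredT) //=; apply: eq_bigr => i _.
  by rewrite natr_sum mulr_sumr.
apply: (@le_trans _ _ (\sum_i p i * (arrivals a t i)%:R -
    \sum_i p i * (\sum_(m | i \in ends m) D m)%:R)).
  by rewrite lerD2r; apply: offline_value_le.
rewrite -sumrB (bigD1 rt) //= pslack // !mul0r subrr add0r mulr_sumr.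
apply: ler_sum => i ni; rewrite -mulrBr.
have -> : (arrivals a t i)%:R - (\sum_(m | i \in ends m) D m)%:R = (Q i)%:R :> R.
  rewrite (conservation dep_par ends_pm edge_pm pm_inj HTP a t ni).
  rewrite (sum_incident (f := D)) // (negPf ni) -/D -/Q.
  by rewrite [X in _ - X]natrD !natrD; ring.
apply: ler_wpM2r => //; apply: (@le_trans _ _ (rew (pm i))).
  rewrite pact ?pmE // ends_pm // (bigD1 i) ?inE ?eqxx //= lerDl.
  exact: sumr_ge0.
by apply: le_bigmax_cond; rewrite (pm_edge edge_pm).
Qed.

Lemma mean_regret_le t :
  word_mean lam t (fun w => offline_value ends rew (arrivals (nth rt w) t) -
    \sum_m rew m * (performed ends TP (nth rt w) t m)%:R) <=
  2 * rew_max rew z * (n%:R ^+ 2 / eps).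
Proof.
have e0 := eps_gt0; have e1 := eps_le1.
have n1 : 1 <= n%:R :> R by rewrite ler1n; case: (rt) => /= k; lia.
have n0 : 0 < n%:R :> R by lra.
have rm0 : 0 <= rew_max rew z.
  by apply: bigmax_ge_id.
apply: (@le_trans _ _ (word_mean lam t (fun w => rew_max rew z *
    \sum_(i | i != rt) ((run ends TP (nth rt w) t).1 i)%:R))).
  by apply: ler_word_mean => [i|w _]; [apply: ltW|apply: regret_path_le].
rewrite word_meanZ [2 * _]mulrC -mulrA; apply: ler_wpM2l => //.
have et0 : 0 < eps / n%:R by apply: divr_gt0.
have le_eta x : n%:R * (eps / n%:R) <= altsum rt par dep lam x.
  by rewrite mulrC divfK ?gt_eqF //; apply: eps_le_altsum.
apply: le_trans (mean_queue dep_par ends_pm edge_pm pm_inj HTP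
  (fun i => ltW (lam_gt0 i)) lam1 et0 le_eta t) _.
(* The choice [eta = eps / n] makes the first factor at most 3/2, since [eps <= 1 <= n]. *)
have -> : n%:R * ((2 + n%:R * (eps / n%:R) ^+ 2) / (2 * (eps / n%:R))) =
    (2 + eps ^+ 2 / n%:R) / 2 * (n%:R ^+ 2 / eps) :> R.
  by field; rewrite !gt_eqF.
apply: ler_wpM2r; first by rewrite divr_ge0 ?exprn_ge0 // ltW.
have : eps ^+ 2 / n%:R <= 1.
  by rewrite ler_pdivrMr // mul1r; apply: le_trans n1; rewrite expr2 mulr_ile1 // ltW.
lra.
Qed.

(** Depth 0 is treated apart: the exponent in the theorem is then -1, but no edges are left and the
    maximum takes its default 0. *)
Lemma rew_max_depth0 : tree_depth ends E rt = 0%N -> rew_max rew z = 0.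
Proof.
move=> d0; rewrite /rew_max big_pred0 // => m; rewrite edge_pm.
apply/existsP => -[i /andP[ni _]].
have : (dep i <= tree_depth ends E rt)%N by apply: leq_bigmax.
by rewrite d0 dep_par.
Qed.

End Main.

Lemma regret_le_mean (R : realType) (n : nat) (mT : finType)
    (ends : mT -> {set 'I_n}) (rew : mT -> R) (lam : 'I_n -> R)
    (d : measure_display) (Omega : measurableType d) (P : probability Omega R)
    (X : nat -> Omega -> 'I_n) (TP : policy n mT) (rt : 'I_n) (B : R) (T : nat) :
  arrival_process P lam X ->
  (forall t, word_mean lam t (fun w => offline_value ends rew (arrivals (nth rt w) t) -
    \sum_m rew m * (performed ends TP (nth rt w) t m)%:R) <= B) ->
  (regret ends rew P X TP T <= B%:E)%E.
Proof.
move=> HX HB; apply: ge_ereal_sup => _ [t _ <-].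
have agree om k : (k < t)%N -> X k om = nth rt (mkseq (X ^~ om) t) k.
  by move=> kt; rewrite nth_mkseq.
pose f w := offline_value ends rew (arrivals (nth rt w) t).
pose g w := \sum_m rew m * (performed ends TP (nth rt w) t m)%:R.
have -> : offline_reward ends rew P X t = (word_mean lam t f)%:E.
  rewrite -(expectation_word HX); congr ('E_P[_])%E; apply: funext => om /=.
  by rewrite /f (eq_arrivals (@agree om)).
have -> : policy_reward ends rew P X TP t = (word_mean lam t g)%:E.
  rewrite -(expectation_word HX); congr ('E_P[_])%E; apply: funext => om /=.
  by rewrite /g /performed (eq_run ends TP (@agree om)).
rewrite -EFinB lee_fin; apply: le_trans (HB t).
rewrite -mulN1r -word_meanZ -word_meanD /word_mean.
by under eq_bigr => w _ do rewrite mulN1r.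
Qed.

(** For positive depth the exponent is nonnegative, so the bound without the depth factor implies
    the stated one. *)
Lemma depth_factor_ge1 (R : realType) (d : nat) (x : R) : 0 < x -> (0 < d)%N ->
  1 <= 2 ^+ d * (1 + x^-1) ^ ((d%:Z - 1) %/ 2)%Z.
Proof.
move=> x0; case: d => // d _.
have -> : (d.+1%:Z - 1)%R = d%:Z by rewrite -[in LHS]addn1 PoszD addrK.
have xi : 0 <= x^-1 by rewrite invr_ge0 ltW.
rewrite divz_nat -exprnP; apply: mulr_ege1; apply: exprn_ege1; lra.
Qed.

Theorem mainTheorem2 (R : realType) :
  exists C : R, 0 < C /\
  forall (n : nat) (mT : finType) (ends : mT -> {set 'I_n}) (rew : mT -> R)
    (lam : 'I_n -> R) (d : measure_display) (Omega : measurableType d)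
    (P : probability Omega R) (X : nat -> Omega -> 'I_n)
    (z : mT -> R) (s : 'I_n -> R) (rt : 'I_n) (TP : policy n mT),
  two_way ends ->
  (forall m, 0 < rew m) ->
  (forall i, 0 < lam i) ->
  \sum_i lam i = 1 ->
  arrival_process P lam X ->
  gpg_solution ends rew lam z s ->
  is_tree ends (active_matches z) ->
  under_demanded s = [set rt] ->
  is_tree_priority ends (active_matches z) (under_demanded s) rt TP ->
  forall T : nat, (1 <= T)%N ->
  (regret ends rew P X TP T <=
   (C * rew_max rew z * (n%:R ^+ 2 *
      2 ^+ tree_depth ends (active_matches z) rt / gpg_eps z s) *
    (1 + (gpg_eps z s)^-1) ^
      (((tree_depth ends (active_matches z) rt)%:Z - 1) %/ 2)%Z)%:E)%E.
Proof.
exists 2; split => // n mT ends rew lam d Omega P X z s rt TP _ _ lam0 lam1 HX Hgpg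
  [conn _] Hunder HTP T _.
rewrite Hunder in HTP.
have srt : 0 < s rt.
  by have := set11 rt; rewrite -Hunder inE.
have e0 : 0 < gpg_eps z s := @gpg_eps_gt0 _ _ _ z s (inr rt) srt.
apply: (regret_le_mean (rt := rt) T HX) => t.
have rm0 : 0 <= rew_max rew z by apply: bigmax_ge_id.
(* Without matches there is no [m0] to pass to [parent_edges]; then zero prices are dual feasible
   and the offline value is at most 0. *)
have [m0 _|mT0] := pickP mT; last first.
  apply: (@le_trans _ _ (word_mean lam t (fun=> 0 * 0))).
    apply: ler_word_mean => [i|w _]; first exact: ltW.
    rewrite [X in _ - X]big_pred0 // subr0 mul0r.
    apply: le_trans (offline_value_le (p := fun=> 0) _ _ _) _ => // [m|].
      by have := mT0 m.
    by rewrite big1 // => i _; rewrite mul0r.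
  rewrite word_meanZ mul0r; apply: mulr_ge0.
    by rewrite !mulr_ge0 ?exprn_ge0 ?invr_ge0 // ltW.
  by apply: exprz_ge0; rewrite addr_ge0 ?invr_ge0 // ltW.
have lt_card := card_active_matches Hgpg.2 srt.
have [par [pm [dep_par ends_pm edge_pm pm_inj]]] := parent_edges rt conn lt_card m0.
apply: le_trans (mean_regret_le lam0 lam1 Hgpg Hunder HTP dep_par ends_pm
  edge_pm pm_inj t) _.
set dd := tree_depth _ _ _.
have -> : 2 * rew_max rew z * (n%:R ^+ 2 * 2 ^+ dd / gpg_eps z s) *
    (1 + (gpg_eps z s)^-1) ^ ((dd%:Z - 1) %/ 2)%Z =
  2 * rew_max rew z * (n%:R ^+ 2 / gpg_eps z s) *
    (2 ^+ dd * (1 + (gpg_eps z s)^-1) ^ ((dd%:Z - 1) %/ 2)%Z) by ring.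
case: (posnP dd) => [d0|dpos].
  by rewrite (rew_max_depth0 rew dep_par edge_pm d0) mulr0 !mul0r.
rewrite ler_peMr ?depth_factor_ge1 // mulr_ge0 //; first exact: mulr_ge0.
by rewrite divr_ge0 ?exprn_ge0 // ltW.
Qed.
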